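(* Let $k$ be a field and let $P=\{(0,0),(1,0),(0,1),(1,1)\}$ be the square poset with the product order. Let $S_{00}$ and $S_{10}$ be the simple $P$-persistence modules supported at the vertices $(0,0)$ and $(1,0)$ respectively, and let $M=S_{00}\oplus S_{10}$. Then $M$ has a non-trivial space of first-order deformations; specifically, $\dim_k\mathrm{Ext}^1(M,M)=1$.
   Context: For a poset $P$, viewed as a small category with a unique morphism $p\to q$ whenever $p\le q$, a $P$-persistence module is a (covariant) functor $M:P\to\mathbf{Vec}_k$ to the category of $k$-vector spaces. For finite $P$, finite-dimensional $P$-persistence modules are identified with finite-dimensional modules over the incidence algebra $A=kP$, and $\mathrm{Ext}^i=\mathrm{Ext}^i_A$ is computed in this abelian category (equivalently, in the functor category). The simple module supported at $v\in P$ takes the value $k$ at $v$ and $0$ at every other vertex. The space of first-order deformations of $M$ is $\mathrm{Ext}^1(M,M)$. *)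

(* Defs.v *)
From HB Require Import structures.
From mathcomp Require Import all_boot all_order all_algebra.
From mathcomp Require Import boolp.
From mathcomp Require freeg.

Set Implicit Arguments.
Unset Strict Implicit.
Unset Printing Implicit Defensive.

Import Order.TTheory GRing.Theory.
Local Open Scope quotient_scope.
Local Open Scope ring_scope.

(* Persistence modules take values in all k-vector spaces (lmodType k), not   *)
(* only finite-dimensional ones, and Ext is computed in this functor category *)
(* from projective resolutions.                                               *)

Local Obligation Tactic := idtac.

Section LinearAlgebra.
Context {k : fieldType}.

Definition lker_pred (U V : lmodType k) (f : {linear U -> V}) : {pred U} :=
  [pred x | f x == 0].

Fact lker_submod (U V : lmodType k) (f : {linear U -> V}) :
  submod_closed (lker_pred f).
Proof.
split=> [|a x y]; rewrite !inE ?linear0 // => /eqP fx /eqP fy.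
by rewrite linearP fx fy scaler0 addr0.
Qed.
HB.instance Definition _ (U V : lmodType k) (f : {linear U -> V}) :=
  GRing.isSubmodClosed.Build k U (lker_pred f) (lker_submod f).

Record lkernel (U V : lmodType k) (f : {linear U -> V}) := LKernel {
  lker_val : U; lker_valP : lker_val \in lker_pred f }.

Section KernelSpace.
Variables (U V : lmodType k) (f : {linear U -> V}).
HB.instance Definition _ := [isSub of lkernel f for @lker_val U V f].
HB.instance Definition _ := [Choice of lkernel f by <:].
HB.instance Definition _ := [SubChoice_isSubLmodule of lkernel f by <:].
End KernelSpace.

Definition sub_zmod (V : lmodType k) (S : submodClosed V) : {pred V} := S.
HB.instance Definition _ (V : lmodType k) (S : submodClosed V) :=
  GRing.isZmodClosed.Build V (sub_zmod S)
    (GRing.submod_closedB (GRing.submodClosedP S)).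

Definition lquot (V : lmodType k) (S : submodClosed V) : Type :=
  Quotient.quot (sub_zmod S).

Section QuotientSpace.
Variables (V : lmodType k) (S : submodClosed V).
HB.instance Definition _ := GRing.Zmodule.on (lquot S).

Definition lquot_scale (a : k) (x : lquot S) : lquot S :=
  \pi_(lquot S) (a *: repr x).

Lemma lquotW (Q : lquot S -> Prop) :
  (forall x, Q (\pi_(lquot S) x)) -> forall y, Q y.
Proof. by move=> Qpi y; rewrite -[y]reprK. Qed.

Lemma lquot_eqP (x y : V) :
  reflect (\pi_(lquot S) x = \pi_(lquot S) y) (x - y \in S).
Proof.
have -> : (x - y \in S) = (\pi_(lquot S) x == \pi_(lquot S) y).
  exact: (Quotient.idealrBE (sub_zmod S) x y).
exact: eqP.
Qed.

Lemma lquot_scaleE a (x : V) :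
  lquot_scale a (\pi_(lquot S) x) = \pi_(lquot S) (a *: x).
Proof. by apply/lquot_eqP; rewrite -scalerBr rpredZ //; apply/lquot_eqP/reprK. Qed.

Lemma lquot_piD (x y : V) :
  \pi_(lquot S) (x + y) = \pi_(lquot S) x + \pi_(lquot S) y.
Proof. exact: (Quotient.pi_add (sub_zmod S) x y). Qed.

Fact lquot_scaleA a b x :
  lquot_scale a (lquot_scale b x) = lquot_scale (a * b) x.
Proof. by elim/lquotW: x => x; rewrite !lquot_scaleE scalerA. Qed.
Fact lquot_scale1 : left_id 1 lquot_scale.
Proof. by elim/lquotW=> x; rewrite lquot_scaleE scale1r. Qed.
Fact lquot_scaleDr : right_distributive lquot_scale +%R.
Proof.
move=> a; elim/lquotW=> x; elim/lquotW=> y.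
by rewrite -lquot_piD !lquot_scaleE -lquot_piD scalerDr.
Qed.
Fact lquot_scaleDl x : {morph lquot_scale^~ x : a b / a + b}.
Proof.
by elim/lquotW: x => x a b /=; rewrite !lquot_scaleE scalerDl lquot_piD.
Qed.
HB.instance Definition _ := GRing.Zmodule_isLmodule.Build k (lquot S)
  lquot_scaleA lquot_scale1 lquot_scaleDr lquot_scaleDl.
End QuotientSpace.

(* Vector.axiom n V is the type of linear bijections from V to 'rV[k]_n.       *)
Definition has_dim (V : lmodType k) (n : nat) : Prop :=
  inhabited (Vector.axiom n V).

End LinearAlgebra.

Section PersistenceModules.
Context {k : fieldType} {d : Order.disp_t} {P : porderType d}.

Record persmod := PersMod {
  pm_obj :> P -> lmodType k;
  pm_map : forall p q : P, (p <= q)%O -> {linear pm_obj p -> pm_obj q};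
  pm_map_id : forall (p : P) (h : (p <= p)%O) x, pm_map h x = x;
  pm_map_comp : forall (p q r : P) (hpq : (p <= q)%O) (hqr : (q <= r)%O)
    (hpr : (p <= r)%O) x, pm_map hqr (pm_map hpq x) = pm_map hpr x }.

Record phom (M N : persmod) := PHom {
  phom_fun :> forall p : P, M p -> N p;
  phom_linear : forall p, linear (@phom_fun p);
  phom_natural : forall (p q : P) (h : (p <= q)%O) x,
    phom_fun (pm_map M h x) = pm_map N h (phom_fun x) }.
Arguments phom_fun {M N} f p x : rename.
Arguments phom_linear {M N} f p : rename.
Arguments phom_natural {M N} f {p q} h x : rename.

HB.instance Definition _ (M N : persmod) (f : phom M N) (p : P) :=
  GRing.isLinear.Build k (M p) (N p) *:%R (f p) (phom_linear f p).

Lemma phomP (M N : persmod) (f g : phom M N) :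
  (forall p x, f p x = g p x) -> f = g.
Proof.
case: f g => [f fl fn] [g gl gn] /= e.
have efg : f = g by apply: functional_extensionality_dep => p; apply: funext => x.
by subst g; congr PHom; apply: Prop_irrelevance.
Qed.

HB.instance Definition _ (M N : persmod) := gen_eqMixin (phom M N).
HB.instance Definition _ (M N : persmod) := gen_choiceMixin (phom M N).

Section HomSpace.
Variables M N : persmod.
Implicit Types f g : phom M N.

Program Definition phom_zero : phom M N := @PHom M N (fun p x => 0) _ _.
Next Obligation. by move=> p a x y /=; rewrite scaler0 addr0. Qed.
Next Obligation. by move=> p q h x /=; rewrite linear0. Qed.

Program Definition phom_opp f : phom M N := @PHom M N (fun p x => - f p x) _ _.
Next Obligation. by move=> f p a x y /=; rewrite linearP opprD scalerN. Qed.
Next Obligation. by move=> f p q h x /=; rewrite phom_natural linearN. Qed.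

Program Definition phom_add f g : phom M N :=
  @PHom M N (fun p x => f p x + g p x) _ _.
Next Obligation. by move=> f g p a x y /=; rewrite !linearP scalerDr addrACA. Qed.
Next Obligation. by move=> f g p q h x /=; rewrite !phom_natural linearD. Qed.

Program Definition phom_scale (c : k) f : phom M N :=
  @PHom M N (fun p x => c *: f p x) _ _.
Next Obligation.
by move=> c f p a x y /=; rewrite linearP scalerDr !scalerA mulrC.
Qed.
Next Obligation. by move=> c f p q h x /=; rewrite phom_natural linearZ. Qed.

Fact phom_addA : associative phom_add.
Proof. by move=> f g h; apply: phomP => p x /=; rewrite addrA. Qed.
Fact phom_addC : commutative phom_add.
Proof. by move=> f g; apply: phomP => p x /=; rewrite addrC. Qed.
Fact phom_add0 : left_id phom_zero phom_add.
Proof. by move=> f; apply: phomP => p x /=; rewrite add0r. Qed.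
Fact phom_addN : left_inverse phom_zero phom_opp phom_add.
Proof. by move=> f; apply: phomP => p x /=; rewrite addNr. Qed.
HB.instance Definition _ := GRing.isZmodule.Build (phom M N)
  phom_addA phom_addC phom_add0 phom_addN.

Fact phom_scaleA a b f : phom_scale a (phom_scale b f) = phom_scale (a * b) f.
Proof. by apply: phomP => p x /=; rewrite scalerA. Qed.
Fact phom_scale1 : left_id 1 phom_scale.
Proof. by move=> f; apply: phomP => p x /=; rewrite scale1r. Qed.
Fact phom_scaleDr : right_distributive phom_scale +%R.
Proof. by move=> a f g; apply: phomP => p x /=; rewrite scalerDr. Qed.
Fact phom_scaleDl f : {morph phom_scale^~ f : a b / a + b}.
Proof. by move=> a b; apply: phomP => p x /=; rewrite scalerDl. Qed.
HB.instance Definition _ := GRing.Zmodule_isLmodule.Build k (phom M N)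
  phom_scaleA phom_scale1 phom_scaleDr phom_scaleDl.

End HomSpace.

Program Definition phom_comp (L M N : persmod) (g : phom M N) (f : phom L M) :
  phom L N := @PHom L N (fun p x => g p (f p x)) _ _.
Next Obligation. by move=> L M N g f p a x y /=; rewrite !linearP. Qed.
Next Obligation. by move=> L M N g f p q h x /=; rewrite !phom_natural. Qed.

Lemma phom_comp_linear (L M N : persmod) (f : phom L M) :
  linear (fun g : phom M N => phom_comp g f).
Proof. by move=> a g h; apply: phomP. Qed.

(* Epimorphisms of persistence modules are the pointwise surjections. *)
Definition psurjective (M N : persmod) (g : phom M N) : Prop :=
  forall p y, exists x, g p x = y.

Definition pexact (L M N : persmod) (f : phom L M) (g : phom M N) : Prop :=
  forall p x, g p x = 0 <-> exists y, f p y = x.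

Definition projective (Q : persmod) : Prop :=
  forall (M N : persmod) (g : phom M N) (f : phom Q N),
    psurjective g -> exists h : phom Q M, phom_comp g h = f.

Record proj_resolution (M : persmod) := ProjResolution {
  pr_obj :> nat -> persmod;
  pr_d : forall n, phom (pr_obj n.+1) (pr_obj n);
  pr_aug : phom (pr_obj 0) M;
  pr_proj : forall n, projective (pr_obj n);
  pr_aug_surj : psurjective pr_aug;
  pr_exact0 : pexact (pr_d 0) pr_aug;
  pr_exact : forall n, pexact (pr_d n.+1) (pr_d n) }.

Section Kernel.
Variables (M N : persmod) (f : phom M N).

Definition ker_obj (p : P) : lmodType k := lkernel (f p).

Fact ker_map_subproof (p q : P) (h : (p <= q)%O) (x : ker_obj p) :
  pm_map M h (val x) \in lker_pred (f q).
Proof.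
by rewrite inE /= phom_natural; case: x => x /= /eqP ->; rewrite linear0.
Qed.

Definition ker_map (p q : P) (h : (p <= q)%O) (x : ker_obj p) : ker_obj q :=
  LKernel (ker_map_subproof h x).

Fact ker_map_linear (p q : P) (h : (p <= q)%O) : linear (@ker_map p q h).
Proof. by move=> a x y; apply: val_inj; rewrite /= linearP. Qed.
HB.instance Definition _ (p q : P) (h : (p <= q)%O) :=
  GRing.isLinear.Build k (ker_obj p) (ker_obj q) *:%R (@ker_map p q h)
    (ker_map_linear h).

Program Definition ker_mod : persmod :=
  @PersMod ker_obj (fun p q h => @ker_map p q h) _ _.
Next Obligation. by move=> p h x; apply: val_inj; rewrite /= pm_map_id. Qed.
Next Obligation.
by move=> p q r ? ? hpr x; apply: val_inj; rewrite /= (pm_map_comp _ _ hpr).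
Qed.

Program Definition ker_incl : phom ker_mod M :=
  @PHom ker_mod M (fun p x => lker_val x) _ _.
Next Obligation. by []. Qed.
Next Obligation. by []. Qed.

End Kernel.

(* Enough projectives: the free module on a family of sets X p (p in P) is    *)
(* the direct sum over p and x in X p of the representables k[p <= -]; for    *)
(* the cover of M, take X p to be the underlying set of M p.                  *)
Section Free.
Import freeg.

Section Lift.
Variables (K : choiceType) (V : lmodType k).

Lemma fglift_linear (f : K -> V) : linear (fglift f).
Proof.
have liftB := lift_is_additive f; have lift0 : fglift f 0 = 0.
  by rewrite -(subrr 0) liftB subrr.
have liftN x : fglift f (- x) = - fglift f x by rewrite -sub0r liftB lift0 sub0r.
have liftD x y : fglift f (x + y) = fglift f x + fglift f y.
  by rewrite -{1}[y]opprK liftB liftN opprK.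
move=> a x y; rewrite liftD; congr (_ + _).
rewrite -{2}[x]freeg_sumE -[a *: x]/(fgscale a x) /fgscale.
rewrite !(big_morph _ liftD lift0) scaler_sumr; apply: eq_bigr => i _.
by rewrite !liftU scalerA.
Qed.
HB.instance Definition _ (f : K -> V) :=
  GRing.isLinear.Build k {freeg K / k} V *:%R (fglift f) (fglift_linear f).

Lemma freeg_ext (f g : {linear {freeg K / k} -> V}) :
  (forall x : K, f << x >> = g << x >>) -> f =1 g.
Proof.
move=> fg x; rewrite -[x]freeg_sumE !linear_sum; apply: eq_bigr => i _.
suff -> : << coeff i x *g i >> = coeff i x *: << i >> :> {freeg K / k}.
  by rewrite !linearZ fg.
by apply/eqP/freeg_eqP => y; rewrite coeffZ !coeffU mul1r.
Qed.

Lemma fgliftU1 (f : K -> V) x : fglift f << x >> = f x.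
Proof. by rewrite liftU scale1r. Qed.

End Lift.

Variable M : persmod.

Definition free_gen (q : P) : choiceType :=
  {x : {p : P & M p} | (tag x <= q)%O}.

Definition free_widen (p q : P) (h : (p <= q)%O) (x : free_gen p) :
  free_gen q := exist _ (sval x) (le_trans (svalP x) h).

Definition free_obj (q : P) : lmodType k := {freeg (free_gen q) / k}.

Definition free_map (p q : P) (h : (p <= q)%O) :
    {linear free_obj p -> free_obj q} :=
  fglift (fun x => << free_widen h x >> : free_obj q).

Program Definition free_mod : persmod := @PersMod free_obj free_map _ _.
Next Obligation.
move=> p h; apply: (freeg_ext (g := idfun)) => x.
by rewrite /free_map/= fgliftU1; congr << _ >>; apply: val_inj.
Qed.
Next Obligation.
move=> p q r hpq hqr hpr.
apply: (freeg_ext (f := free_map hqr \o free_map hpq)) => x.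
by rewrite /free_map/= !fgliftU1; congr << _ >>; apply: val_inj.
Qed.

Definition free_ext (N : persmod) (a : forall x : {p : P & M p}, N (tag x)) :
    forall q, free_obj q -> N q :=
  fun q => fglift (fun x : free_gen q => pm_map N (svalP x) (a (sval x))).

Program Definition free_lift (N : persmod)
    (a : forall x : {p : P & M p}, N (tag x)) : phom free_mod N :=
  @PHom free_mod N (free_ext a) _ _.
Next Obligation. by move=> N a p; apply: linearP. Qed.
Next Obligation.
move=> N a p q h.
pose F : {linear free_obj p -> N q} :=
  fglift (fun x : free_gen q => pm_map N (svalP x) (a (sval x)))
    \o free_map h.
pose G : {linear free_obj p -> N q} := pm_map N h
    \o fglift (fun x : free_gen p => pm_map N (svalP x) (a (sval x))).
apply: (freeg_ext (f := F) (g := G)) => x.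
rewrite /F /G /free_map /= !fgliftU1.
by rewrite (pm_map_comp _ _ (svalP (free_widen h x))).
Qed.

Definition free_unit (x : {p : P & M p}) : free_mod (tag x) :=
  << exist _ x (lexx (tag x)) : free_gen (tag x) >>.

Lemma free_lift_unit (N : persmod) (a : forall x : {p : P & M p}, N (tag x)) x :
  free_lift a (tag x) (free_unit x) = a x.
Proof. by rewrite /= /free_ext /free_unit fgliftU1 pm_map_id. Qed.

Lemma free_hom_ext (N : persmod) (f g : phom free_mod N) :
  (forall x, f (tag x) (free_unit x) = g (tag x) (free_unit x)) -> f = g.
Proof.
move=> fg; apply: phomP => q.
pose F : {linear free_mod q -> N q} := f q.
pose G : {linear free_mod q -> N q} := g q.
apply: (freeg_ext (f := F) (g := G)) => -[x hx]; rewrite /F /G /=.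
have -> : << exist _ x hx >> = pm_map free_mod hx (free_unit x).
  by rewrite /= /free_map /free_unit /= fgliftU1; congr << _ >>; apply: val_inj.
by rewrite !phom_natural fg.
Qed.

Lemma free_projective : projective free_mod.
Proof.
move=> A B g f g_surj.
have lift x : {y | g (tag x) y = f (tag x) (free_unit x)}.
  by apply: constructive_indefinite_description; apply: g_surj.
exists (free_lift (fun x => sval (lift x))); apply: free_hom_ext => x.
pose a x := sval (lift x).
have := svalP (lift x); rewrite -/(a x) => <-.
by rewrite -(free_lift_unit a).
Qed.

Definition free_cover : phom free_mod M := free_lift (fun x => tagged x).

Lemma free_cover_surj : psurjective free_cover.
Proof.
move=> p y; exists (free_unit (Tagged (fun p => M p) y)).
exact: (free_lift_unit (fun x => tagged x) (Tagged (fun p => M p) y)).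
Qed.

End Free.

Section StandardResolution.
Variable M : persmod.

Fixpoint syzygy (n : nat) : persmod :=
  if n is m.+1 then ker_mod (free_cover (syzygy m)) else M.

Definition std_d (n : nat) :
    phom (free_mod (syzygy n.+1)) (free_mod (syzygy n)) :=
  phom_comp (ker_incl (free_cover (syzygy n))) (free_cover (syzygy n.+1)).

Fact std_exact0 : pexact (std_d 0) (free_cover M).
Proof.
move=> p x; split=> [fx|[y <-]].
  have kx : x \in lker_pred (free_cover M p) by rewrite inE; apply/eqP.
  have [y yE] := free_cover_surj (LKernel kx : syzygy 1 p).
  by exists y; rewrite -[LHS]/(lker_val (free_cover (syzygy 1) p y)) yE.
by apply/eqP; apply: (lker_valP (free_cover (syzygy 1) p y)).
Qed.

Fact std_exact n : pexact (std_d n.+1) (std_d n).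
Proof.
move=> p x; split=> [fx|[y <-]].
  have kx : x \in lker_pred (free_cover (syzygy n.+1) p).
    by rewrite inE; apply/eqP; apply: val_inj.
  have [y yE] := free_cover_surj (LKernel kx : syzygy n.+2 p).
  by exists y; rewrite -[LHS]/(lker_val (free_cover (syzygy n.+2) p y)) yE.
pose z := free_cover (syzygy n.+2) p y.
have /eqP z0 : free_cover (syzygy n.+1) p (lker_val z) == 0 := lker_valP z.
by rewrite -[LHS]/(lker_val (free_cover (syzygy n.+1) p (lker_val z))) z0.
Qed.

Definition std_resolution : proj_resolution M :=
  @ProjResolution M (fun n => free_mod (syzygy n)) std_d (free_cover M)
    (fun n => @free_projective (syzygy n)) (@free_cover_surj M)
    std_exact0 std_exact.

End StandardResolution.

(* Ext^n(M, N) is the n-th cohomology of the complex Hom(R, N).               *)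
Section Ext.
Variables (M : persmod) (R : proj_resolution M) (N : persmod).

Definition hom_d (n : nat) (f : phom (R n) N) : phom (R n.+1) N :=
  phom_comp f (pr_d R n).

HB.instance Definition _ (n : nat) :=
  GRing.isLinear.Build k (phom (R n) N) (phom (R n.+1) N) *:%R (@hom_d n)
    (phom_comp_linear (N := N) (pr_d R n)).

Definition cocycle (n : nat) : lmodType k := lkernel (@hom_d n).

Definition is_coboundary (n : nat) : phom (R n) N -> Prop :=
  match n with
  | 0 => fun f => f = 0
  | m.+1 => fun f => exists g : phom (R m) N, hom_d g = f
  end.

Definition coboundary (n : nat) : {pred cocycle n} :=
  fun z => `[< is_coboundary (lker_val z) >].

Fact coboundary_submod n : submod_closed (@coboundary n).
Proof.
split=> [|a x y].
  by apply/asboolP; case: n => [//|n]; exists 0; rewrite linear0.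
move=> /asboolP bx /asboolP byy; apply/asboolP; case: n x y bx byy => [|n] x y /=.
  by move=> -> ->; rewrite scaler0 addr0.
move=> [g gx] [h hy]; exists (a *: g + h).
by rewrite -[RHS]/(a *: lker_val x + lker_val y) -gx -hy; apply: phom_comp_linear.
Qed.
HB.instance Definition _ (n : nat) :=
  GRing.isSubmodClosed.Build k (cocycle n) (@coboundary n)
    (coboundary_submod n).

Definition ext_of (n : nat) : lmodType k := lquot (@coboundary n).

End Ext.

Definition Ext (n : nat) (M N : persmod) : lmodType k :=
  ext_of (std_resolution M) N n.

Definition deformation_space (M : persmod) : lmodType k := Ext 1 M M.

Section DirectSum.
Variables M N : persmod.

Definition dsum_map (p q : P) (h : (p <= q)%O) (x : M p * N p) : M q * N q :=
  (pm_map M h x.1, pm_map N h x.2).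

Fact dsum_map_linear (p q : P) (h : (p <= q)%O) : linear (@dsum_map p q h).
Proof. by move=> a x y; rewrite /dsum_map /= !linearP. Qed.
HB.instance Definition _ (p q : P) (h : (p <= q)%O) :=
  GRing.isLinear.Build k (M p * N p)%type (M q * N q)%type *:%R
    (@dsum_map p q h) (dsum_map_linear h).

Program Definition dsum : persmod :=
  @PersMod (fun p => (M p * N p)%type) (fun p q h => @dsum_map p q h) _ _.
Next Obligation.
by move=> p h [x y]; rewrite /= /dsum_map !pm_map_id.
Qed.
Next Obligation.
move=> p q r ? ? hpr [x y].
by rewrite /= /dsum_map /= !(pm_map_comp _ _ hpr).
Qed.

End DirectSum.

(* The boolean p == v is read as a dimension, so the value is k^1 at v and    *)
(* k^0 elsewhere.                                                             *)
Section Simple.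
Variable v : P.

Definition simple_obj (p : P) : lmodType k := 'rV[k]_(p == v).

Definition simple_map (p q : P) (h : (p <= q)%O) :
    {linear simple_obj p -> simple_obj q} :=
  mulmxr (pid_mx 1 : 'M[k]_(p == v, q == v)).

Program Definition simple : persmod := @PersMod simple_obj simple_map _ _.
Next Obligation.
move=> p h x; rewrite /= -[RHS]mulmx1; congr (x *m _).
apply/matrixP => i j; rewrite !mxE -val_eqE.
by have := ltn_ord i; case: (p == v) i j => -[[|i] ?] [[|j] ?].
Qed.
Next Obligation.
move=> p q r hpq hqr hpr x; rewrite /= -mulmxA; congr (x *m _).
rewrite mul_pid_mx; have [_ //|nqv] := eqVneq q v.
apply/matrixP => i j; have pv : p = v.
  by apply/eqP; case: (p == v) i => // -[].
have rv : r = v by apply/eqP; case: (r == v) j => // -[].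
by case/eqP: nqv; apply: le_anti; rewrite -{1}rv -pv hpq hqr.
Qed.

End Simple.

End PersistenceModules.

Arguments persmod k {d} P.
Arguments simple k {d P} v.

(* The two-element chain 0 < 1 is bool, with false < true.                    *)
Definition square : finPOrderType _ := (bool *p bool)%type.
Definition sq00 : square := (false, false).
Definition sq10 : square := (true, false).

(* Main.v *)
(* The argument works for M = S_v + S_u whenever u covers v.  Let K be the
   kernel of the free cover F -> M, so that Ext^1(M, M) is Hom(K, M) modulo
   restrictions of morphisms F -> M.  The generator of F attached to a generator
   of M at v is sent by the structure map v <= u to an element w of K at u, since
   M(v) -> M(u) is zero.  Evaluation at w is a linear map Hom(K, M) -> M(u) = k.
   It kills restrictions, again because M(v) -> M(u) is zero; a morphism killing
   w extends to F along pointwise splittings of the cover; and it is onto, as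
   shown by lifting the cover to the non-split extension of S_v by S_u.  In the
   last step the constant module k stands in for that extension, with which it
   agrees at v and u. *)
From HB Require Import structures.
Require Import Defs.
From mathcomp Require Import all_boot all_order all_algebra.
From mathcomp Require Import boolp.

Set Implicit Arguments.
Unset Strict Implicit.
Unset Printing Implicit Defensive.

Import Order.TTheory GRing.Theory.
Local Open Scope quotient_scope.
Local Open Scope ring_scope.

(** * Quotient dimensions and row spaces of length 0 or 1 *)

Section LinearAlgebra.
Context {k : fieldType}.

(** First isomorphism theorem: [f] descends to the quotient through representatives, and chosen
    preimages give the inverse. *)
Lemma lquot_has_dim (V : lmodType k) (S : submodClosed V) n
    (f : {linear V -> 'rV[k]_n}) :
  (forall x, x \in S <-> f x = 0) -> (forall y, exists x, f x = y) ->
  has_dim (lquot S) n.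
Proof.
move=> kerf surjf; pose g (x : lquot S) := f (repr x); pose pi (x : V) : lquot S := \pi_(lquot S) x.
have gpi x : g (pi x) = f x.
  apply/eqP; rewrite -subr_eq0 -linearB; apply/eqP/kerf/lquot_eqP.
  exact: reprK.
have piP (x : lquot S) : exists y, x = pi y.
  by exists (repr x); rewrite /pi reprK.
have pi_linear a x y : a *: pi x + pi y = pi (a *: x + y).
  by rewrite /pi lquot_piD -lquot_scaleE.
have glin : linear g.
  move=> a x y; have [[{}x ->] [{}y ->]] := (piP x, piP y).
  by rewrite pi_linear !gpi linearP.
have ginj : injective g.
  move=> x y; have [[{}x ->] [{}y ->]] := (piP x, piP y); rewrite !gpi => fxy.
  by apply/lquot_eqP/kerf; rewrite linearB fxy subrr.
pose s y := pi (sval (constructive_indefinite_description (surjf y))).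
have sK y : g (s y) = y.
  by rewrite gpi; case: constructive_indefinite_description.
constructor; exists g => //; exists s => // x.
exact/ginj/sK.
Qed.

Lemma has_dim_nontrivial (V : lmodType k) n :
  has_dim V n.+1 -> exists x : V, x <> 0.
Proof.
case=> -[f flin [g fK gK]]; exists (g (const_mx 1)) => g0.
(* [flin] speaks of [a *: x + y], so 0 is written as [-1 *: 0 + 0]. *)
have f0 : f 0 = 0.
  by rewrite -[X in f X](addNr 0) -scaleN1r flin scaleN1r addNr.
move: (gK (const_mx 1)); rewrite g0 f0 => /matrixP /(_ 0 0).
by rewrite !mxE => /esym/eqP; rewrite oner_eq0.
Qed.

(** For a boolean length this is the only coordinate, or 0 on the zero space, and needs no index. *)
Definition coord_sum n (x : 'rV[k]_n) : k := \sum_i x 0 i.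

Lemma coord_sum_linear n : scalar (@coord_sum n).
Proof.
move=> a x y; rewrite /coord_sum mulr_sumr -big_split.
by apply: eq_bigr => i _; rewrite !mxE.
Qed.
HB.instance Definition _ n :=
  GRing.isLinear.Build k 'rV[k]_n k *%R (@coord_sum n) (coord_sum_linear (n:=n)).

Lemma coord_sumK (b : bool) (x : 'rV[k]_b) : coord_sum x *: const_mx 1 = x.
Proof.
apply/rowP; rewrite /coord_sum; case: b x => /= x i; last by case: i.
by rewrite big_ord1 !mxE mulr1 [i]ord1.
Qed.

Lemma coord_sum1 (b : bool) (x : k) :
  b -> coord_sum (x *: const_mx 1 : 'rV[k]_b) = x.
Proof. by case: b => // _; rewrite /coord_sum big_ord1 !mxE mulr1. Qed.

Lemma rV0_eq0 (b : bool) (x : 'rV[k]_b) : ~~ b -> x = 0.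
Proof. by case: b x => // x _; apply: thinmx0. Qed.

End LinearAlgebra.

(** * Free modules and cocycles of degree one *)

Section Persistence.
Context {k : fieldType} {d : Order.disp_t} {P : porderType d}.

Lemma phom0 (M N : persmod k P) (f : phom M N) p : f p 0 = 0.
Proof. exact: linear0. Qed.

Lemma phomD (M N : persmod k P) (f : phom M N) p x y :
  f p (x + y) = f p x + f p y.
Proof. exact: linearD. Qed.

Lemma phomB (M N : persmod k P) (f : phom M N) p x y :
  f p (x - y) = f p x - f p y.
Proof. exact: linearB. Qed.

Lemma phomZ (M N : persmod k P) (f : phom M N) p a x :
  f p (a *: x) = a *: f p x.
Proof. exact: linearZ. Qed.

Lemma phom_kerE (M N : persmod k P) (f : phom M N) p x :
  (x \in lker_pred (f p)) = (f p x == 0).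
Proof. by []. Qed.

Lemma free_mod_ext (M : persmod k P) (q : P) (V : lmodType k)
    (f g : {linear free_mod M q -> V}) :
  (forall (x : {p : P & M p}) (h : (tag x <= q)%O),
     f (pm_map (free_mod M) h (free_unit x)) =
     g (pm_map (free_mod M) h (free_unit x))) -> f =1 g.
Proof.
move=> fg; apply: freeg_ext => -[x h].
have := fg x h; rewrite /= /free_map /free_unit fgliftU1.
suff -> : free_widen h (exist _ x (lexx (tag x))) = exist _ x h by [].
exact: val_inj.
Qed.

(** By exactness the kernel of the cover of [syzygy M 1] is the image of [std_d M 1], on which a
    cocycle vanishes. So [z] descends along this surjection. *)
Lemma cocycle_factor (M N : persmod k P) (z : cocycle (std_resolution M) N 1) :
  exists g : phom (syzygy M 1) N,
    lker_val z = phom_comp g (free_cover (syzygy M 1)).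
Proof.
case: z => z /= /eqP zd.
have zker p x : free_cover (syzygy M 1) p x = 0 -> z p x = 0.
  move=> x0; have [|y <-] := (@std_exact _ _ _ M 0 p x).1.
    by rewrite -[LHS]/(lker_val (free_cover (syzygy M 1) p x)) x0.
  exact: (congr1 (fun f : phom _ _ => f p y) zd).
pose s p y := sval (constructive_indefinite_description
  (@free_cover_surj _ _ _ (syzygy M 1) p y)).
have sK p y : free_cover (syzygy M 1) p (s p y) = y.
  by rewrite /s; case: constructive_indefinite_description.
have zE p x y : free_cover (syzygy M 1) p x = y -> z p x = z p (s p y).
  by move=> xy; apply/eqP; rewrite -subr_eq0 -phomB zker // phomB sK xy subrr.
have glin p : linear (fun y => z p (s p y)).
  by move=> a x y; rewrite -phomZ -phomD; apply/esym/zE; rewrite phomD phomZ !sK.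
have gnat p q (h : (p <= q)%O) x :
    z q (s q (pm_map (syzygy M 1) h x)) = pm_map N h (z p (s p x)).
  by rewrite -phom_natural; apply/esym/zE; rewrite phom_natural sK.
by exists (PHom glin gnat); apply: phomP => p x; apply: zE.
Qed.

Lemma factor_cocycle (M N : persmod k P) (g : phom (syzygy M 1) N) :
  phom_comp g (free_cover (syzygy M 1)) \in
    lker_pred (@hom_d _ _ _ _ (std_resolution M) N 1).
Proof.
rewrite inE; apply/eqP/phomP => p y.
have /eqP y0 := lker_valP (free_cover (syzygy M 2) p y).
rewrite -[LHS]/(g p (free_cover (syzygy M 1) p
                       (lker_val (free_cover (syzygy M 2) p y)))) y0.
exact: phom0.
Qed.

Definition const_mod (V : lmodType k) : persmod k P :=
  @PersMod _ _ _ (fun _ => V) (fun _ _ _ => idfun)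
    (fun _ _ _ => erefl) (fun _ _ _ _ _ _ _ => erefl).

Lemma simple_map0 (v p q : P) (h : (p <= q)%O) (x : simple k v p) :
  p != q -> pm_map (simple k v) h x = 0.
Proof.
move=> npq; have [qv|nqv] := eqVneq q v; last exact: rV0_eq0.
by rewrite [x]rV0_eq0 ?linear0 // -qv.
Qed.

(** * Self-extensions of the sum of two simples at a covering pair *)

Section Cover.
Variables v u : P.
Hypothesis ltvu : (v < u)%O.
Hypothesis cover_vu : forall p, (v <= p)%O -> (p < u)%O -> p = v.

Let M : persmod k P := dsum (simple k v) (simple k u).
Let F : persmod k P := free_mod M.
Let K : persmod k P := syzygy M 1.
Let levu : (v <= u)%O := ltW ltvu.

Lemma dsum_eq0 p (x : M p) : p != v -> p != u -> x = 0.
Proof.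
by case: x => x y pv pu; apply: (congr2 pair); apply: rV0_eq0.
Qed.

Lemma dsum_map0 (p q : P) (h : (p <= q)%O) (x : M p) :
  p != q -> pm_map M h x = 0.
Proof.
case: x => x y npq.
by apply: (congr2 pair); apply: simple_map0.
Qed.

Definition genv (p : P) : F p :=
  free_unit (Tagged (fun p => M p) (const_mx 1, 0 : simple k u p)).
Definition genu (p : P) : F p :=
  free_unit (Tagged (fun p => M p) (0 : simple k v p, const_mx 1)).

Lemma cover_unit (N : persmod k P) (x : {p : P & N p}) :
  free_cover N (tag x) (free_unit x) = tagged x.
Proof. exact: (free_lift_unit (fun x => tagged x)). Qed.

Lemma cover_genv p : free_cover M p (genv p) = (const_mx 1, 0).
Proof. exact: (cover_unit (Tagged (fun p => M p) _)). Qed.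

Lemma cover_genu p : free_cover M p (genu p) = (0, const_mx 1).
Proof. exact: (cover_unit (Tagged (fun p => M p) _)). Qed.

(** A linear section of the cover at each point separately, not natural in [p]. *)
Definition splitting (p : P) (x : M p) : F p :=
  coord_sum x.1 *: genv p + coord_sum x.2 *: genu p.

Lemma splitting_linear p : linear (@splitting p).
Proof.
move=> a x y; rewrite -[LHS]/(coord_sum (a *: x.1 + y.1) *: genv p +
  coord_sum (a *: x.2 + y.2) *: genu p) !coord_sum_linear.
by rewrite !scalerDl scalerDr !scalerA addrACA.
Qed.
HB.instance Definition _ p :=
  GRing.isLinear.Build k (M p) (F p) *:%R (@splitting p) (@splitting_linear p).

Lemma splittingK p (x : M p) : free_cover M p (splitting x) = x.
Proof.
rewrite phomD !phomZ cover_genv cover_genu; case: x => x y.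
by apply: (congr2 pair); rewrite /= scaler0 ?addr0 ?add0r coord_sumK.
Qed.

Fact class_gen_subproof :
  pm_map F levu (genv v) \in lker_pred (free_cover M u).
Proof. by rewrite phom_kerE phom_natural dsum_map0 // lt_eqF. Qed.

Definition class_gen : K u := LKernel class_gen_subproof.

(** The extension is [g] after the pointwise projection [r] of [F] onto [K] along [splitting]; [g0]
    makes this composite natural. *)
Lemma extend_from_kernel (g : phom K M) :
  g u class_gen = 0 ->
  exists h : phom F M, g = phom_comp h (ker_incl (free_cover M)).
Proof.
move=> g0.
have kerP p x : x - splitting (free_cover M p x) \in lker_pred (free_cover M p).
  by rewrite phom_kerE phomB splittingK subrr.
pose r p x : K p := LKernel (kerP p x).
have rE p x : val (r p x) = x - splitting (free_cover M p x) by [].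
have rlin p : linear (r p).
  move=> a x y; apply: val_inj.
  rewrite -[RHS]/(a *: val (r p x) + val (r p y)) !rE phomD phomZ.
  by rewrite splitting_linear scalerBr opprD addrACA.
have hlin p : linear (fun x => g p (r p x)) by move=> a x y; rewrite rlin phomD phomZ.
have hnat p q (h : (p <= q)%O) x :
    g q (r q (pm_map F h x)) = pm_map M h (g p (r p x)).
  rewrite -phom_natural; apply/eqP; rewrite -subr_eq0 -phomB; apply/eqP.
  have [epq|npq] := eqVneq p q.
    by subst q; rewrite !pm_map_id subrr phom0.
  (* [y] is the naturality defect of [r]. The section at [q] drops out because [M] has zero maps
     between distinct points. *)
  set y := _ - _; have yE : val y = pm_map F h (splitting (free_cover M p x)).
    rewrite /y -[LHS]/(val (r q (pm_map F h x)) - pm_map F h (val (r p x))) !rE.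
    rewrite phom_natural dsum_map0 // linear0 subr0 linearB /=.
    by rewrite opprB addrC subrK.
  (* Unless [p = v] and [q = u], either [M q] or [y] is zero; in the remaining case [y] is a
     multiple of [class_gen]. *)
  have [pv|npv] := eqVneq p v; last first.
    have [pu|npu] := eqVneq p u.
      apply: dsum_eq0; last by rewrite eq_sym -pu.
      by apply: contraTneq (h) => ->; rewrite pu lt_geF.
    have -> : y = 0 by apply: val_inj; rewrite yE [free_cover M p x]dsum_eq0 // !linear0.
    exact: phom0.
  subst p; have [qu|nqu] := eqVneq q u; last by apply: dsum_eq0; rewrite // eq_sym.
  subst q; suff -> : y = coord_sum (free_cover M v x).1 *: class_gen.
    by rewrite phomZ g0 scaler0.
  apply: val_inj; rewrite yE /= linearD !linearZ /=.
  rewrite [(free_cover M v x).2]rV0_eq0 // linear0 scale0r addr0.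
  by rewrite (Prop_irrelevance h levu).
exists (PHom hlin hnat); apply: phomP => p x.
have /eqP x0 : free_cover M p (val x) == 0 := lker_valP x.
rewrite -[RHS]/(g p (r p (val x))); congr (g p _); apply: val_inj.
by rewrite rE x0 linear0 subr0.
Qed.

(** The free generator on [class_gen] lifts it along the cover of [K], so this evaluates the
    morphism induced by [z] at [class_gen], in the summand at [u]. *)
Definition ext_class_map (z : cocycle (std_resolution M) M 1) : 'rV[k]_1 :=
  const_mx (coord_sum (lker_val z u (free_unit (Tagged (fun p => K p) class_gen))).2).

Lemma ext_class_map_linear : linear ext_class_map.
Proof.
move=> a x y; apply/rowP => i; rewrite !mxE.
exact: linearP.
Qed.
HB.instance Definition _ :=
  GRing.isLinear.Build k (cocycle (std_resolution M) M 1) 'rV[k]_1 *:%R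
    ext_class_map ext_class_map_linear.

Lemma ext_class_map_eq0 z :
  z \in @coboundary _ _ _ _ (std_resolution M) M 1 <-> ext_class_map z = 0.
Proof.
split=> [/asboolP [g gz] | z0].
  suff zw0 : lker_val z u (free_unit (Tagged (fun p => K p) class_gen)) = 0.
    by apply/rowP => i; rewrite !mxE zw0 [coord_sum _]linear0.
  rewrite -gz -[LHS]/(g u (val (free_cover K u
    (free_unit (Tagged (fun p => K p) class_gen))))).
  rewrite (cover_unit (Tagged (fun p => K p) class_gen)).
  rewrite -[LHS]/(g u (pm_map F levu (genv v))) phom_natural.
  by rewrite dsum_map0 // lt_eqF.
have [g zg] := cocycle_factor z.
have [|h gh] := @extend_from_kernel g.
  move/rowP/(_ 0): z0; rewrite !mxE zg => z0.
  have {}z0 : coord_sum (g u class_gen).2 = 0.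
    rewrite -[RHS]z0; congr (coord_sum (g u _).2).
    exact/esym/(cover_unit (Tagged (fun p => K p) class_gen)).
  rewrite [LHS]surjective_pairing; apply: (congr2 pair).
    by apply: rV0_eq0; rewrite gt_eqF.
  by rewrite -[LHS]coord_sumK z0 scale0r.
apply/asboolP; exists h; rewrite zg gh.
exact: phomP.
Qed.

Lemma ext_class_map_surj y : exists z, ext_class_map z = y.
Proof.
pose a (x : {p : P & M p}) : const_mod k^o (tag x) := coord_sum (tagged x).1.
pose h : phom F (const_mod k^o) := free_lift a.
(* Strictly below [u], [h] is the first coordinate of the cover: a generator at [v] reaches only [v]
   itself there, as [u] covers [v]. *)
have hK p (x : K p) : (p < u)%O -> h p (val x) = 0.
  move=> pu; suff -> : h p (val x) = coord_sum (free_cover M p (val x)).1.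
    by have /eqP -> : free_cover M p (val x) == 0 := lker_valP x; rewrite [LHS]linear0.
  pose c q (z : M q) : k^o := coord_sum z.1.
  have c_linear : linear (c p) by move=> b z t; apply: coord_sum_linear.
  pose C : {linear M p -> k^o} :=
    HB.pack (c p) (GRing.isLinear.Build k (M p) k^o *:%R (c p) c_linear).
  apply: (free_mod_ext (f := h p) (g := C \o free_cover M p)) => s sp.
  rewrite -[LHS]/(h p (pm_map F sp (free_unit s))).
  rewrite -[RHS]/(c p (free_cover M p (pm_map F sp (free_unit s)))).
  rewrite !phom_natural free_lift_unit cover_unit.
  case: s sp => q z; rewrite [tag _]/= => sp.
  rewrite -[LHS]/(c q z) -[RHS]/(c p (pm_map M sp z)).
  have [eqp|nqp] := eqVneq q p.
    by subst q; rewrite pm_map_id.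
  rewrite dsum_map0 // /c [z.1]rV0_eq0 ?[RHS]linear0 ?linear0 //.
  apply: contraNneq nqp => qv.
  by rewrite qv (cover_vu _ pu) // -qv.
(* Cutting [h] down to the point [u], where [const_mx 1] is nonempty, is natural on [K] by [hK]; the
   factor is the prescribed value. *)
pose gfun p (x : K p) : M p := (0, (y 0 0 * h p (val x)) *: const_mx 1).
have glin p : linear (@gfun p).
  move=> b x x'; pose t (x : K p) : simple k u p := (y 0 0 * h p (val x)) *: const_mx 1.
  rewrite -[RHS]/(b *: (0 : simple k v p) + 0, b *: t x + t x') /gfun scaler0 addr0.
  congr (_, _); rewrite -[val _]/(b *: val x + val x') phomD phomZ /t.
  by rewrite scalerA -scalerDl mulrDr mulrCA.
have gnat p q (pq : (p <= q)%O) x :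
    gfun q (pm_map K pq x) = pm_map M pq (gfun p x).
  have [epq|npq] := eqVneq p q.
    by subst q; rewrite !pm_map_id.
  rewrite dsum_map0 //; apply: (congr2 pair) => //.
  have /orP[/eqP qu|nqu] := orbN (q == u); last exact: rV0_eq0.
  rewrite -[val _]/(pm_map F pq (val x)) phom_natural -[pm_map _ _ _]/(h p (val x)).
  by rewrite hK ?mulr0 ?scale0r // lt_neqAle -qu npq.
pose g := PHom glin gnat.
exists (LKernel (factor_cocycle g)); apply/rowP => i; rewrite ord1 !mxE.
have hgen : h u (val class_gen) = 1.
  rewrite -[val _]/(pm_map F levu (genv v)) phom_natural.
  rewrite -[LHS]/(h v (genv v)) (free_lift_unit a (Tagged (fun p => M p) _)).
  by rewrite -[LHS]/(coord_sum (const_mx 1)) -[const_mx 1]scale1r coord_sum1.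
rewrite -[LHS]/(coord_sum (g u (free_cover K u
  (free_unit (Tagged (fun p => K p) class_gen)))).2).
rewrite (cover_unit (Tagged (fun p => K p) class_gen)).
rewrite -[LHS]/(coord_sum ((y 0 0 * h u (val class_gen)) *: const_mx 1)).
by rewrite hgen mulr1 coord_sum1.
Qed.

Lemma cover_deformation_dim : has_dim (deformation_space M) 1.
Proof. exact: (lquot_has_dim ext_class_map_eq0 ext_class_map_surj). Qed.

End Cover.
End Persistence.

(** * The covering pair (0,0) < (1,0) in the square *)

Theorem proposition5p3 (k : fieldType) :
  let M : persmod k square := dsum (simple k sq00) (simple k sq10) in
  (exists x : deformation_space M, x <> 0) /\
  has_dim (deformation_space M) 1.
Proof.
have dimM : has_dim
    (deformation_space (dsum (simple k sq00) (simple k sq10))) 1.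
  (* The covering condition is checked on the four points. *)
  by apply: cover_deformation_dim => // -[[] []].
split; [exact: has_dim_nontrivial dimM | exact: dimM].
Qed.
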